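(* Let $n\ge 1$ and let $A=a_0(x)D_x^{n}+a_1(x)D_x^{n-1}+\dots+a_n(x)$ be a linear differential operator of order $n$. Let $\varphi$ be a nowhere vanishing function with $A\varphi=0$, put $g=(\log\varphi)_x=\varphi_x/\varphi$, and let $\lambda\neq 0$ be a constant. Then the equation for eigenfunctions $A\psi=\lambda\psi$ admits the invertible substitution $$\hat\psi=(D_x-g)\psi .$$ That is, there exist a linear differential operator $\tilde A$ of order $n-1$ and a linear differential operator $\hat A$ of order $n$ such that $\psi\mapsto(D_x-g)\psi$ is a bijection from the set of solutions $\psi$ of $A\psi=\lambda\psi$ onto the set of solutions $\hat\psi$ of $\hat A\hat\psi=\lambda\hat\psi$, and its inverse is given by $\lambda\psi=\tilde A\hat\psi$.
   Context: $D_x=\frac{d}{dx}$. All functions (coefficients of operators, $\varphi$, $g$, $\psi$, $\hat\psi$) are smooth complex-valued functions on a fixed open interval of the real line. An operator $a_0D_x^n+\dots+a_n$ has order $n$ when its leading coefficient $a_0$ is nowhere vanishing on the interval. A substitution $\hat\psi=(D_x-g)\psi$ in the equation $A\psi=\lambda\psi$ is called invertible if it carries solutions of this equation to solutions of another linear differential equation $\hat A\hat\psi=\lambda\hat\psi$ of the same order and $\psi$ is recovered from $\hat\psi$ by a differential operator. *)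

(* Defs.v *)
From Stdlib Require Import Reals.
From Coquelicot Require Import Coquelicot.

(* A function on an open interval I is represented by a total function R -> C
   of which only the values on I matter: all hypotheses and conclusions are
   restricted to I, and two functions are identified when they agree on I.
   As I is open, derivatives at points of I do not depend on the extension. *)

Definition Rbar_interval (l r : Rbar) (x : R) : Prop :=
  Rbar_lt l x /\ Rbar_lt x r.

Definition eq_on (I : R -> Prop) (f g : R -> C) : Prop :=
  forall x, I x -> f x = g x.

Definition nowhere_zero_on (I : R -> Prop) (f : R -> C) : Prop :=
  forall x, I x -> f x <> RtoC 0.

(* [Derive] is only available for real-valued functions; [is_derive_Dx] below
   checks that this is the derivative of f as a map into the real normed
   space C. *)
Definition Dx (f : R -> C) : R -> C :=
  fun x => (Derive (fun t => Re (f t)) x, Derive (fun t => Im (f t)) x).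

Definition Dx_n (k : nat) (f : R -> C) : R -> C := Nat.iter k Dx f.

Definition smooth_on (I : R -> Prop) (f : R -> C) : Prop :=
  forall (k : nat) (x : R), I x ->
    ex_derive (K := R_AbsRing) (V := C_R_NormedModule) (Dx_n k f) x.

(* a_0 D_x^n + a_1 D_x^(n-1) + ... + a_n applied to f; the functions [a k]
   with k > n play no role. *)
Definition diff_op (n : nat) (a : nat -> R -> C) (f : R -> C) : R -> C :=
  fun x => sum_n (fun k => Cmult (a k x) (Dx_n (n - k) f x)) n.

Definition has_order (I : R -> Prop) (n : nat) (a : nat -> R -> C) : Prop :=
  (forall k, (k <= n)%nat -> smooth_on I (a k)) /\ nowhere_zero_on I (a 0%nat).

Definition eigenfunction (I : R -> Prop) (n : nat) (a : nat -> R -> C)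
    (lambda : C) (psi : R -> C) : Prop :=
  smooth_on I psi /\
  eq_on I (diff_op n a psi) (fun x => Cmult lambda (psi x)).

Definition log_deriv (phi : R -> C) : R -> C :=
  fun x => Cdiv (Dx phi x) (phi x).

(* (D_x - g) psi *)
Definition Dx_minus (g psi : R -> C) : R -> C :=
  fun x => Cminus (Dx psi x) (Cmult (g x) (psi x)).

Definition bijection_on (I : R -> Prop) (S T : (R -> C) -> Prop)
    (F : (R -> C) -> (R -> C)) : Prop :=
  (forall psi, S psi -> T (F psi)) /\
  (forall psi1 psi2, S psi1 -> S psi2 ->
     eq_on I (F psi1) (F psi2) -> eq_on I psi1 psi2) /\
  (forall chi, T chi -> exists psi, S psi /\ eq_on I (F psi) chi).

Lemma is_derive_Dx (f : R -> C) (x : R) :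
  ex_derive (K := R_AbsRing) (V := C_R_NormedModule) f x ->
  is_derive (K := R_AbsRing) (V := C_R_NormedModule) f x (Dx f x).
Proof.
intros [l Hl].
replace (Dx f x) with l; [exact Hl |].
assert (H1 : is_derive (fun t => Re (f t)) x (Re l)).
{ apply filterdiff_ext_lin with (fun y : R => Re (scal y l : C_R_NormedModule));
    [| reflexivity].
  apply (filterdiff_comp (V := C_R_NormedModule) f Re _ Re Hl).
  apply filterdiff_linear, (is_linear_fst (U := R_NormedModule) (V := R_NormedModule)). }
assert (H2 : is_derive (fun t => Im (f t)) x (Im l)).
{ apply filterdiff_ext_lin with (fun y : R => Im (scal y l : C_R_NormedModule));
    [| reflexivity].
  apply (filterdiff_comp (V := C_R_NormedModule) f Im _ Im Hl).
  apply filterdiff_linear, (is_linear_snd (U := R_NormedModule) (V := R_NormedModule)). }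
destruct l as [l1 l2]; unfold Dx; f_equal; symmetry.
- exact (is_derive_unique _ _ _ H1).
- exact (is_derive_unique _ _ _ H2).
Qed.

(* Main.v *)
Require Import Defs.
From Stdlib Require Import Reals Lra Lia.
From Coquelicot Require Import Coquelicot.
(* Reals exports another Dx, from Rderiv, which must not shadow this one. *)
Import Defs.

Local Open Scope C_scope.

(** Write g for the logarithmic derivative of phi, so that the kernel of
    D - g is spanned by phi.  Euclidean division of A by the monic first-order
    operator D - g on the right gives A = B (D - g) + r, where r is a function
    because the remainder has order 0.  Applied to phi this reads r phi = 0,
    and phi has no zeros, so r = 0 and A = B (D - g) ([diff_op_factor]).

    The transformed operator is obtained by swapping the factors,
    Ahat = (D - g) B, which again has order n and the leading coefficient of A
    ([Dx_minus_diff_op]).  The rest is the algebra of two linear maps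
    P = D - g and B with A = B P and Ahat = P B: if B P psi = lambda psi, then
    chi = P psi satisfies P B chi = P (lambda psi) = lambda chi and
    B chi = lambda psi; conversely, if P B chi = lambda chi, then
    psi = B chi / lambda satisfies P psi = chi and B P psi = B chi = lambda psi.
    So P and B / lambda are inverse bijections between the two
    lambda-eigenspaces; this is where lambda <> 0 is used.

    What remains is to see that the operators with smooth coefficients are
    closed under the operations involved.  Composition on the left with D
    ([Dx_diff_op]) gives the Leibniz expansion of D^m (g f) ([Dx_n_mult]), and
    this is what a step of the division ([diff_op_division]) needs:
    D^(m+1) f = D^m ((D - g) f) + D^m (g f), whose second term has order at
    most m in f. *)

(** * Differentiation of complex-valued functions *)

Definition derivable_at (f : R -> C) (x : R) : Prop :=
  ex_derive (K := R_AbsRing) (V := C_R_NormedModule) f x.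

Definition has_derivative (f : R -> C) (x : R) (l : C) : Prop :=
  is_derive (K := R_AbsRing) (V := C_R_NormedModule) f x l.

(** Recombines real derivatives: products and inverses in C are rational
    expressions in the real and imaginary parts, so their derivatives reduce to
    real calculus. *)
Lemma has_derivative_pair (f : R -> C) (x u v : R) :
  is_derive (fun t => Re (f t)) x u -> is_derive (fun t => Im (f t)) x v ->
  has_derivative f x (u, v).
Proof.
intros Hu Hv; unfold has_derivative.
pose proof (is_derive_plus (K := R_AbsRing) (V := C_R_NormedModule) _ _ _ _ _
  (is_derive_scal_l (V := C_R_NormedModule) _ _ _ (1%R, 0%R) Hu)
  (is_derive_scal_l (V := C_R_NormedModule) _ _ _ (0%R, 1%R) Hv)) as H.
evar_last.
- eapply (is_derive_ext (K := R_AbsRing) (V := C_R_NormedModule)); [| exact H].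
  intros t; apply injective_projections; cbn; unfold Re, Im, mult; cbn; ring.
- apply injective_projections; cbn; unfold mult; cbn; ring.
Qed.

Lemma has_derivative_components (f : R -> C) (x : R) (l : C) :
  has_derivative f x l ->
  is_derive (fun t => Re (f t)) x (Re l) /\
  is_derive (fun t => Im (f t)) x (Im l).
Proof.
intros Hl; split.
- apply filterdiff_ext_lin with (fun y : R => Re (scal y l : C_R_NormedModule));
    [| reflexivity].
  apply (filterdiff_comp (V := C_R_NormedModule) f Re _ Re Hl).
  apply filterdiff_linear,
    (is_linear_fst (U := R_NormedModule) (V := R_NormedModule)).
- apply filterdiff_ext_lin with (fun y : R => Im (scal y l : C_R_NormedModule));
    [| reflexivity].
  apply (filterdiff_comp (V := C_R_NormedModule) f Im _ Im Hl).
  apply filterdiff_linear,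
    (is_linear_snd (U := R_NormedModule) (V := R_NormedModule)).
Qed.

Lemma Dx_unique (f : R -> C) (x : R) (l : C) :
  has_derivative f x l -> Dx f x = l.
Proof.
intros H; destruct (has_derivative_components _ _ _ H) as [H1 H2].
destruct l as [u v]; unfold Dx; f_equal; apply is_derive_unique; assumption.
Qed.

Lemma has_derivative_plus (f g : R -> C) (x : R) (l m : C) :
  has_derivative f x l -> has_derivative g x m ->
  has_derivative (fun t => f t + g t) x (l + m).
Proof.
exact (is_derive_plus (K := R_AbsRing) (V := C_R_NormedModule) f g x l m).
Qed.

Lemma has_derivative_const (c : C) (x : R) : has_derivative (fun _ => c) x 0.
Proof. exact (is_derive_const (K := R_AbsRing) (V := C_R_NormedModule) c x). Qed.

Lemma has_derivative_mult (f g : R -> C) (x : R) (l m : C) :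
  has_derivative f x l -> has_derivative g x m ->
  has_derivative (fun t => f t * g t) x (l * g x + f x * m).
Proof.
intros Hf Hg.
destruct (has_derivative_components _ _ _ Hf) as [F1 F2].
destruct (has_derivative_components _ _ _ Hg) as [G1 G2].
set (f1 := fun t => Re (f t)) in *; set (f2 := fun t => Im (f t)) in *.
set (g1 := fun t => Re (g t)) in *; set (g2 := fun t => Im (g t)) in *.
assert (E1 : ex_derive f1 x) by (eexists; exact F1).
assert (E2 : ex_derive f2 x) by (eexists; exact F2).
assert (E3 : ex_derive g1 x) by (eexists; exact G1).
assert (E4 : ex_derive g2 x) by (eexists; exact G2).
assert (D1 : Derive (fun t => f1 t) x = Re l) by now apply is_derive_unique.
assert (D2 : Derive (fun t => f2 t) x = Im l) by now apply is_derive_unique.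
assert (D3 : Derive (fun t => g1 t) x = Re m) by now apply is_derive_unique.
assert (D4 : Derive (fun t => g2 t) x = Im m) by now apply is_derive_unique.
assert (H1 : is_derive (fun t => f1 t * g1 t - f2 t * g2 t)%R x
  (Re l * g1 x + f1 x * Re m - (Im l * g2 x + f2 x * Im m))%R).
{ auto_derive; [tauto |].
  rewrite D1, D2, D3, D4; ring. }
assert (H2 : is_derive (fun t => f1 t * g2 t + f2 t * g1 t)%R x
  (Re l * g2 x + f1 x * Im m + (Im l * g1 x + f2 x * Re m))%R).
{ auto_derive; [tauto |].
  rewrite D1, D2, D3, D4; ring. }
evar_last.
- exact (has_derivative_pair (fun t => f t * g t) x _ _ H1 H2).
- apply injective_projections; unfold f1, f2, g1, g2, Re, Im; cbn; ring.
Qed.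

(** Only differentiability is read off from the components: the value of the
    derivative follows more cheaply from f * / f = 1, in
    [has_derivative_inv]. *)
Lemma derivable_at_inv (f : R -> C) (x : R) :
  f x <> 0 -> derivable_at f x -> derivable_at (fun t => / f t) x.
Proof.
intros H0 [l Hf].
destruct (has_derivative_components _ _ _ Hf) as [F1 F2].
set (f1 := fun t => Re (f t)) in *; set (f2 := fun t => Im (f t)) in *.
assert (N : (f1 x * (f1 x * 1) + f2 x * (f2 x * 1))%R <> 0%R).
{ intros E; apply H0.
  assert (f1 x = 0%R /\ f2 x = 0%R) as [E1 E2] by (split; nra).
  apply injective_projections; assumption. }
assert (E1 : ex_derive f1 x) by (eexists; exact F1).
assert (E2 : ex_derive f2 x) by (eexists; exact F2).
assert (H1 : ex_derive (fun t => f1 t / (f1 t ^ 2 + f2 t ^ 2))%R x)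
  by (auto_derive; tauto).
assert (H2 : ex_derive (fun t => - f2 t / (f1 t ^ 2 + f2 t ^ 2))%R x)
  by (auto_derive; tauto).
destruct H1 as [u Hu], H2 as [v Hv].
exists (u, v); apply has_derivative_pair; assumption.
Qed.

(** * Smooth functions on an open set *)

Lemma locally_eq_on (I : R -> Prop) (HI : open I) (f g : R -> C) (x : R) :
  eq_on I f g -> I x -> locally x (fun t => f t = g t).
Proof. intros E Hx; exact (filter_imp _ _ E (HI x Hx)). Qed.

Lemma Dx_eq_on (I : R -> Prop) (HI : open I) (f g : R -> C) :
  eq_on I f g -> eq_on I (Dx f) (Dx g).
Proof.
intros E x Hx; pose proof (locally_eq_on I HI f g x E Hx) as L.
unfold Dx; f_equal; apply Derive_ext_loc; revert L; apply filter_imp;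
  intros t Et; rewrite Et; reflexivity.
Qed.

Lemma Dx_n_eq_on (I : R -> Prop) (HI : open I) (f g : R -> C) (k : nat) :
  eq_on I f g -> eq_on I (Dx_n k f) (Dx_n k g).
Proof.
intros E; induction k as [| k IH]; [exact E |].
exact (Dx_eq_on I HI _ _ IH).
Qed.

Lemma Dx_n_S (k : nat) (f : R -> C) : Dx_n (S k) f = Dx_n k (Dx f).
Proof. apply Nat.iter_succ_r. Qed.

(** Smoothness is the largest property of functions that implies
    differentiability and passes to the derivative.  This replaces the
    k-th-order Leibniz and quotient formulas in proofs that products and
    inverses are smooth. *)
Lemma smooth_on_coinduction (I : R -> Prop) (HI : open I)
    (P : (R -> C) -> Prop) :
  (forall f, P f -> exists h, P h /\ forall x, I x -> has_derivative f x (h x)) ->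
  forall f, P f -> smooth_on I f.
Proof.
intros step f Pf k x Hx.
assert (H : exists h, P h /\ eq_on I (Dx_n k f) h).
{ clear x Hx; induction k as [| k [h [Ph Eh]]]; [exists f; split; [exact Pf | intros x _; reflexivity] |].
  destruct (step h Ph) as [h' [Ph' D]].
  exists h'; split; [exact Ph' |].
  intros x Hx; change (Dx (Dx_n k f) x = h' x).
  rewrite (Dx_eq_on I HI _ _ Eh x Hx).
  exact (Dx_unique _ _ _ (D x Hx)). }
destruct H as [h [Ph Eh]].
apply (ex_derive_ext_loc (K := R_AbsRing) (V := C_R_NormedModule) h).
- apply (locally_eq_on I HI); [| exact Hx].
  intros t Ht; symmetry; exact (Eh t Ht).
- destruct (step h Ph) as [h' [_ D]]; exists (h' x); exact (D x Hx).
Qed.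

(** The algebra generated by the smooth functions under all operations of
    interest at once.  It is stable under differentiation, whereas, for
    instance, the set of the products of two smooth functions is not. *)
Inductive smooth_alg (I : R -> Prop) : (R -> C) -> Prop :=
| smooth_alg_base f : smooth_on I f -> smooth_alg I f
| smooth_alg_const c : smooth_alg I (fun _ => c)
| smooth_alg_plus f g :
    smooth_alg I f -> smooth_alg I g -> smooth_alg I (fun x => f x + g x)
| smooth_alg_mult f g :
    smooth_alg I f -> smooth_alg I g -> smooth_alg I (fun x => f x * g x)
| smooth_alg_inv f :
    smooth_alg I f -> nowhere_zero_on I f -> smooth_alg I (fun x => / f x).

Lemma smooth_on_Dx (I : R -> Prop) (f : R -> C) :
  smooth_on I f -> smooth_on I (Dx f).
Proof. intros H k x Hx; rewrite <- Dx_n_S; exact (H (S k) x Hx). Qed.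

Lemma smooth_on_derivative (I : R -> Prop) (f : R -> C) (x : R) :
  smooth_on I f -> I x -> has_derivative f x (Dx f x).
Proof. intros H Hx; exact (is_derive_Dx f x (H 0%nat x Hx)). Qed.

(** The derivative is written with the operations of [smooth_alg] only, which
    makes it visibly a member of that algebra.  Its value is found by
    differentiating f * / f = 1. *)
Lemma has_derivative_inv (I : R -> Prop) (HI : open I) (f : R -> C) (x : R)
    (l : C) :
  nowhere_zero_on I f -> I x -> has_derivative f x l ->
  has_derivative (fun t => / f t) x (- (1) * (l * (/ f x * / f x))).
Proof.
intros N Hx Hf.
destruct (derivable_at_inv f x (N x Hx) (ex_intro _ l Hf)) as [m Hm].
change C in m.
assert (E : l * / f x + f x * m = 0).
{ rewrite <- (Dx_unique _ _ _ (has_derivative_mult _ _ _ _ _ Hf Hm)).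
  rewrite (Dx_eq_on I HI _ (fun _ => RtoC 1)); [| | exact Hx].
  - exact (Dx_unique _ _ _ (has_derivative_const 1 x)).
  - intros t Ht; apply Cinv_r; exact (N t Ht). }
replace (- (1) * (l * (/ f x * / f x))) with m; [exact Hm |].
replace m with (/ f x * (l * / f x + f x * m) - / f x * (l * / f x))
  by (field; exact (N x Hx)).
rewrite E; ring.
Qed.

(** Each differentiation rule expresses the derivative of a generated function
    through generated functions, so coinduction applies to the whole algebra. *)
Lemma smooth_alg_smooth (I : R -> Prop) (HI : open I) (f : R -> C) :
  smooth_alg I f -> smooth_on I f.
Proof.
revert f; apply (smooth_on_coinduction I HI); intros f Hf.
induction Hf as [f Hf | c | f g Hf [f' [Pf Df]] Hg [g' [Pg Dg]]
  | f g Hf [f' [Pf Df]] Hg [g' [Pg Dg]] | f Hf [f' [Pf Df]] N].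
- exists (Dx f); split; [apply smooth_alg_base, smooth_on_Dx, Hf |].
  intros x Hx; exact (smooth_on_derivative I f x Hf Hx).
- exists (fun _ => RtoC 0); split; [apply smooth_alg_const |].
  intros x _; apply has_derivative_const.
- exists (fun x => f' x + g' x); split; [now apply smooth_alg_plus |].
  intros x Hx; apply has_derivative_plus; auto.
- exists (fun x => f' x * g x + f x * g' x); split.
  + apply smooth_alg_plus; apply smooth_alg_mult; assumption.
  + intros x Hx; apply has_derivative_mult; auto.
- exists (fun x => - (1) * (f' x * (/ f x * / f x))); split.
  + repeat apply smooth_alg_mult; try assumption;
      [apply (smooth_alg_const I (- (1))) | |]; now apply smooth_alg_inv.
  + intros x Hx; apply (has_derivative_inv I HI); auto.
Qed.

Lemma smooth_on_const (I : R -> Prop) (HI : open I) (c : C) :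
  smooth_on I (fun _ => c).
Proof. apply (smooth_alg_smooth I HI), smooth_alg_const. Qed.

Lemma smooth_on_plus (I : R -> Prop) (HI : open I) (f g : R -> C) :
  smooth_on I f -> smooth_on I g -> smooth_on I (fun x => f x + g x).
Proof.
intros Hf Hg; apply (smooth_alg_smooth I HI).
apply smooth_alg_plus; now apply smooth_alg_base.
Qed.

Lemma smooth_on_mult (I : R -> Prop) (HI : open I) (f g : R -> C) :
  smooth_on I f -> smooth_on I g -> smooth_on I (fun x => f x * g x).
Proof.
intros Hf Hg; apply (smooth_alg_smooth I HI).
apply smooth_alg_mult; now apply smooth_alg_base.
Qed.

Lemma smooth_on_log_deriv (I : R -> Prop) (HI : open I) (phi : R -> C) :
  smooth_on I phi -> nowhere_zero_on I phi -> smooth_on I (log_deriv phi).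
Proof.
intros H N; apply (smooth_on_mult I HI (Dx phi) (fun x => / phi x)).
- now apply smooth_on_Dx.
- apply (smooth_alg_smooth I HI), smooth_alg_inv; [| exact N].
  now apply smooth_alg_base.
Qed.

Lemma smooth_on_eq_on (I : R -> Prop) (HI : open I) (f g : R -> C) :
  eq_on I f g -> smooth_on I f -> smooth_on I g.
Proof.
intros E H k x Hx.
apply (ex_derive_ext_loc (K := R_AbsRing) (V := C_R_NormedModule) (Dx_n k f)).
- apply (locally_eq_on I HI); [| exact Hx]; now apply Dx_n_eq_on.
- exact (H k x Hx).
Qed.

Lemma Dx_plus (I : R -> Prop) (f g : R -> C) (x : R) :
  smooth_on I f -> smooth_on I g -> I x ->
  Dx (fun t => f t + g t) x = Dx f x + Dx g x.
Proof.
intros Hf Hg Hx; apply Dx_unique, has_derivative_plus;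
  now apply (smooth_on_derivative I).
Qed.

Lemma Dx_mult (I : R -> Prop) (f g : R -> C) (x : R) :
  smooth_on I f -> smooth_on I g -> I x ->
  Dx (fun t => f t * g t) x = Dx f x * g x + f x * Dx g x.
Proof.
intros Hf Hg Hx; apply Dx_unique, has_derivative_mult;
  now apply (smooth_on_derivative I).
Qed.

Lemma Dx_scal (I : R -> Prop) (c : C) (f : R -> C) (x : R) :
  smooth_on I f -> I x -> Dx (fun t => c * f t) x = c * Dx f x.
Proof.
intros Hf Hx.
rewrite (Dx_unique _ _ _ (has_derivative_mult _ _ _ _ _ (has_derivative_const c x)
  (smooth_on_derivative I f x Hf Hx))); ring.
Qed.

Lemma Dx_n_smooth (I : R -> Prop) (k : nat) (f : R -> C) :
  smooth_on I f -> smooth_on I (Dx_n k f).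
Proof.
intros H; induction k as [| k IH]; [exact H | exact (smooth_on_Dx I _ IH)].
Qed.

Lemma Dx_n_plus (I : R -> Prop) (HI : open I) (k : nat) (f g : R -> C) :
  smooth_on I f -> smooth_on I g ->
  eq_on I (Dx_n k (fun x => f x + g x)) (fun x => Dx_n k f x + Dx_n k g x).
Proof.
intros Hf Hg; induction k as [| k IH]; [intros x _; reflexivity |].
intros x Hx; change (Dx (Dx_n k (fun x => f x + g x)) x
  = Dx (Dx_n k f) x + Dx (Dx_n k g) x).
rewrite (Dx_eq_on I HI _ _ IH x Hx).
apply (Dx_plus I); [now apply Dx_n_smooth | now apply Dx_n_smooth | exact Hx].
Qed.

(** * The first-order operator D - g *)

Lemma Dx_minus_smooth (I : R -> Prop) (HI : open I) (g f : R -> C) :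
  smooth_on I g -> smooth_on I f -> smooth_on I (Dx_minus g f).
Proof.
intros Hg Hf.
apply (smooth_on_eq_on I HI (fun x => Dx f x + - (1) * (g x * f x))).
- intros x _; unfold Dx_minus; ring.
- apply (smooth_on_plus I HI); [now apply smooth_on_Dx |].
  apply (smooth_on_mult I HI); [now apply (smooth_on_const I HI) |].
  now apply (smooth_on_mult I HI).
Qed.

Lemma Dx_minus_eq_on (I : R -> Prop) (HI : open I) (g f1 f2 : R -> C) :
  eq_on I f1 f2 -> eq_on I (Dx_minus g f1) (Dx_minus g f2).
Proof.
intros E x Hx; unfold Dx_minus.
now rewrite (Dx_eq_on I HI _ _ E x Hx), (E x Hx).
Qed.

Lemma Dx_minus_scal (I : R -> Prop) (c : C) (g f : R -> C) :
  smooth_on I f ->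
  eq_on I (Dx_minus g (fun x => c * f x)) (fun x => c * Dx_minus g f x).
Proof.
intros Hf x Hx; unfold Dx_minus; rewrite (Dx_scal I c f x Hf Hx); ring.
Qed.

Lemma Dx_minus_log_deriv (I : R -> Prop) (phi : R -> C) :
  nowhere_zero_on I phi -> eq_on I (Dx_minus (log_deriv phi) phi) (fun _ => 0).
Proof.
intros N x Hx; unfold Dx_minus, log_deriv; field; exact (N x Hx).
Qed.

(** * The algebra of differential operators *)

Definition smooth_coeffs (I : R -> Prop) (n : nat) (a : nat -> R -> C) : Prop :=
  forall k, (k <= n)%nat -> smooth_on I (a k).

(** The coefficients are listed from the leading one down, so dropping the first
    one lowers the order by one; all inductions on operators below peel off the
    leading term in this way ([diff_op_S]). *)
Definition tail (a : nat -> R -> C) : nat -> R -> C := fun k => a (S k).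

Definition cons_coeff (c : R -> C) (a : nat -> R -> C) : nat -> R -> C :=
  fun k => match k with O => c | S j => a j end.

Lemma smooth_coeffs_tail (I : R -> Prop) (n : nat) (a : nat -> R -> C) :
  smooth_coeffs I (S n) a -> smooth_coeffs I n (tail a).
Proof. intros H k Hk; apply H; lia. Qed.

Lemma smooth_coeffs_cons (I : R -> Prop) (n : nat) (c : R -> C)
    (a : nat -> R -> C) :
  smooth_on I c -> smooth_coeffs I n a -> smooth_coeffs I (S n) (cons_coeff c a).
Proof. intros Hc Ha [| k] Hk; [exact Hc | apply Ha; lia]. Qed.

Lemma smooth_coeffs_axpy (I : R -> Prop) (HI : open I) (n : nat) (p : R -> C)
    (a b : nat -> R -> C) :
  smooth_on I p -> smooth_coeffs I n a -> smooth_coeffs I n b ->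
  smooth_coeffs I n (fun k x => p x * a k x + b k x).
Proof.
intros Hp Ha Hb k Hk; apply (smooth_on_plus I HI); [| exact (Hb k Hk)].
apply (smooth_on_mult I HI); [exact Hp | exact (Ha k Hk)].
Qed.

Lemma diff_op_0 (a : nat -> R -> C) (f : R -> C) (x : R) :
  diff_op 0 a f x = a 0%nat x * f x.
Proof. unfold diff_op; rewrite sum_O; reflexivity. Qed.

Lemma diff_op_S (n : nat) (a : nat -> R -> C) (f : R -> C) (x : R) :
  diff_op (S n) a f x
  = a 0%nat x * Dx_n (S n) f x + diff_op n (tail a) f x.
Proof.
unfold diff_op, sum_n at 1; rewrite sum_Sn_m by lia.
rewrite <- sum_n_m_S; reflexivity.
Qed.

Lemma diff_op_axpy (n : nat) (p : R -> C) (a b : nat -> R -> C) (f : R -> C)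
    (x : R) :
  diff_op n (fun k y => p y * a k y + b k y) f x
  = p x * diff_op n a f x + diff_op n b f x.
Proof.
revert a b; induction n as [| n IH]; intros a b.
- rewrite !diff_op_0; ring.
- rewrite !diff_op_S.
  change (tail (fun k y => p y * a k y + b k y))
    with (fun k y => p y * tail a k y + tail b k y).
  rewrite IH; ring.
Qed.

Lemma diff_op_eq_on (I : R -> Prop) (HI : open I) (n : nat)
    (a : nat -> R -> C) (f g : R -> C) :
  eq_on I f g -> eq_on I (diff_op n a f) (diff_op n a g).
Proof.
intros E x Hx; unfold diff_op; apply sum_n_ext; intros k.
now rewrite (Dx_n_eq_on I HI _ _ _ E x Hx).
Qed.

Lemma diff_op_zero (n : nat) (a : nat -> R -> C) (x : R) :
  diff_op n a (fun _ => 0) x = 0.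
Proof.
assert (Z : forall k t, Dx_n k (fun _ => RtoC 0) t = 0).
{ intros k; induction k as [| k IH]; intros t; [reflexivity |].
  change (Dx (Dx_n k (fun _ => RtoC 0)) t = 0); apply Dx_unique.
  apply (is_derive_ext (K := R_AbsRing) (V := C_R_NormedModule)
    (fun _ => RtoC 0)); [intros s; now rewrite IH |].
  apply has_derivative_const. }
revert a; induction n as [| n IH]; intros a.
- rewrite diff_op_0; ring.
- rewrite diff_op_S, IH, Z; ring.
Qed.

Lemma diff_op_smooth (I : R -> Prop) (HI : open I) (n : nat)
    (a : nat -> R -> C) (f : R -> C) :
  smooth_coeffs I n a -> smooth_on I f -> smooth_on I (diff_op n a f).
Proof.
intros Ha Hf; revert a Ha; induction n as [| n IH]; intros a Ha.
- apply (smooth_on_eq_on I HI (fun x => a 0%nat x * f x)).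
  + intros x _; now rewrite diff_op_0.
  + apply (smooth_on_mult I HI); [apply Ha; lia | exact Hf].
- apply (smooth_on_eq_on I HI
    (fun x => a 0%nat x * Dx_n (S n) f x + diff_op n (tail a) f x)).
  + intros x _; now rewrite diff_op_S.
  + apply (smooth_on_plus I HI).
    * apply (smooth_on_mult I HI); [apply Ha; lia | now apply Dx_n_smooth].
    * apply IH, smooth_coeffs_tail, Ha.
Qed.

(** The composite D A is a_0 D^(n+1) plus an operator of order at most n.  The
    leading coefficient is kept apart because orders have to be tracked
    exactly when the factors are swapped. *)
Lemma Dx_diff_op (I : R -> Prop) (HI : open I) (n : nat) (a : nat -> R -> C) :
  smooth_coeffs I n a ->
  exists c, smooth_coeffs I n c /\
    forall f, smooth_on I f ->
      eq_on I (Dx (diff_op n a f))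
        (fun x => a 0%nat x * Dx_n (S n) f x + diff_op n c f x).
Proof.
revert a; induction n as [| n IH]; intros a Ha.
- exists (fun _ => Dx (a 0%nat)); split.
  + intros k _; apply smooth_on_Dx, Ha; lia.
  + intros f Hf x Hx; rewrite diff_op_0.
    rewrite (Dx_eq_on I HI _ (fun t => a 0%nat t * f t));
      [| intros t _; apply diff_op_0 | exact Hx].
    rewrite (Dx_mult I); [| apply Ha; lia | exact Hf | exact Hx].
    change (Dx_n 1 f) with (Dx f); ring.
- destruct (IH (tail a) (smooth_coeffs_tail I n a Ha)) as [c [Hc Ec]].
  exists (cons_coeff (fun x => Dx (a 0%nat) x + a 1%nat x) c); split.
  + apply smooth_coeffs_cons; [| exact Hc].
    apply (smooth_on_plus I HI); [apply smooth_on_Dx |]; apply Ha; lia.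
  + intros f Hf x Hx; rewrite diff_op_S.
    rewrite (Dx_eq_on I HI _
      (fun t => a 0%nat t * Dx_n (S n) f t + diff_op n (tail a) f t));
      [| intros t _; apply diff_op_S | exact Hx].
    assert (S0 : smooth_on I (a 0%nat)) by (apply Ha; lia).
    pose proof (Dx_n_smooth I (S n) f Hf) as S1.
    rewrite (Dx_plus I); [| now apply (smooth_on_mult I HI)
      | apply (diff_op_smooth I HI); [now apply smooth_coeffs_tail | exact Hf]
      | exact Hx].
    rewrite (Dx_mult I _ _ x S0 S1 Hx), (Ec f Hf x Hx).
    change (Dx (Dx_n (S n) f)) with (Dx_n (S (S n)) f).
    change (tail (cons_coeff (fun x => Dx (a 0%nat) x + a 1%nat x) c)) with c.
    cbn [tail cons_coeff]; unfold tail; ring.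
Qed.

(** Leibniz' rule for D^m (g f), read as an operator of order at most m in f.
    Only the smoothness of the coefficients matters, so binomial coefficients
    never appear. *)
Lemma Dx_n_mult (I : R -> Prop) (HI : open I) (g : R -> C) (m : nat) :
  smooth_on I g ->
  exists c, smooth_coeffs I m c /\
    forall f, smooth_on I f ->
      eq_on I (Dx_n m (fun x => g x * f x)) (diff_op m c f).
Proof.
intros Hg; induction m as [| m [c [Hc Ec]]].
- exists (fun _ => g); split; [intros k _; exact Hg |].
  intros f _ x _; now rewrite diff_op_0.
- destruct (Dx_diff_op I HI m c Hc) as [d [Hd Ed]].
  exists (cons_coeff (c 0%nat) d); split.
  + apply smooth_coeffs_cons; [apply Hc; lia | exact Hd].
  + intros f Hf x Hx.
    change (Dx (Dx_n m (fun t => g t * f t)) x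
      = diff_op (S m) (cons_coeff (c 0%nat) d) f x).
    rewrite (Dx_eq_on I HI _ _ (Ec f Hf) x Hx), (Ed f Hf x Hx), diff_op_S.
    reflexivity.
Qed.

(** Apply D^m to D f = (D - g) f + g f. *)
Lemma Dx_n_S_Dx_minus (I : R -> Prop) (HI : open I) (g f : R -> C) (m : nat) :
  smooth_on I g -> smooth_on I f ->
  eq_on I (Dx_n (S m) f)
    (fun x => Dx_n m (Dx_minus g f) x + Dx_n m (fun t => g t * f t) x).
Proof.
intros Hg Hf x Hx; rewrite Dx_n_S.
rewrite (Dx_n_eq_on I HI _ (fun t => Dx_minus g f t + g t * f t));
  [| intros t _; unfold Dx_minus; ring | exact Hx].
apply (Dx_n_plus I HI); [now apply Dx_minus_smooth | | exact Hx].
now apply (smooth_on_mult I HI).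
Qed.

(** Right Euclidean division by D - g.  One step replaces the leading term
    a_0 D^(m+2) f by a_0 D^(m+1) ((D - g) f), which goes into the quotient, and
    a_0 D^(m+1) (g f), whose order in f is smaller; it is merged with the lower
    terms of the operator, which are divided by induction. *)
Lemma diff_op_division (I : R -> Prop) (HI : open I) (g : R -> C) (m : nat)
    (a : nat -> R -> C) :
  smooth_on I g -> smooth_coeffs I (S m) a ->
  exists b r, smooth_coeffs I m b /\ b 0%nat = a 0%nat /\
    forall f, smooth_on I f ->
      eq_on I (diff_op (S m) a f)
        (fun x => diff_op m b (Dx_minus g f) x + r x * f x).
Proof.
intros Hg; revert a; induction m as [| m IH]; intros a Ha.
- exists (fun _ => a 0%nat), (fun x => a 1%nat x + a 0%nat x * g x).
  split; [intros k _; apply Ha; lia |]; split; [reflexivity |].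
  intros f Hf x Hx; rewrite diff_op_S, !diff_op_0; unfold tail, Dx_minus.
  change (Dx_n 1 f) with (Dx f); ring.
- destruct (Dx_n_mult I HI g (S m) Hg) as [c [Hc Ec]].
  assert (S0 : smooth_on I (a 0%nat)) by (apply Ha; lia).
  destruct (IH (fun k x => a 0%nat x * c k x + tail a k x)) as [b [r [Hb [_ E]]]].
  { apply (smooth_coeffs_axpy I HI); [exact S0 | exact Hc |].
    now apply smooth_coeffs_tail. }
  exists (cons_coeff (a 0%nat) b), r.
  split; [now apply smooth_coeffs_cons |]; split; [reflexivity |].
  intros f Hf x Hx.
  rewrite !diff_op_S, (Dx_n_S_Dx_minus I HI g f (S m) Hg Hf x Hx), (Ec f Hf x Hx).
  change (tail (cons_coeff (a 0%nat) b)) with b.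
  pose proof (E f Hf x Hx) as Ex; rewrite diff_op_axpy in Ex.
  rewrite <- diff_op_S.
  transitivity (a 0%nat x * Dx_n (S m) (Dx_minus g f) x
    + (a 0%nat x * diff_op (S m) c f x + diff_op (S m) (tail a) f x)); [ring |].
  rewrite Ex; cbn [cons_coeff]; ring.
Qed.

(** Since D - g kills phi, the remainder of the division kills phi too, and
    phi is invertible. *)
Lemma diff_op_factor (I : R -> Prop) (HI : open I) (phi : R -> C) (m : nat)
    (a : nat -> R -> C) :
  smooth_on I phi -> nowhere_zero_on I phi -> smooth_coeffs I (S m) a ->
  eq_on I (diff_op (S m) a phi) (fun _ => 0) ->
  exists b, smooth_coeffs I m b /\ b 0%nat = a 0%nat /\
    forall f, smooth_on I f ->
      eq_on I (diff_op (S m) a f) (diff_op m b (Dx_minus (log_deriv phi) f)).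
Proof.
intros Hphi N Ha Ker.
destruct (diff_op_division I HI _ m a (smooth_on_log_deriv I HI phi Hphi N) Ha)
  as [b [r [Hb [Hb0 E]]]].
exists b; split; [exact Hb |]; split; [exact Hb0 |].
assert (R0 : forall x, I x -> r x = 0).
{ intros x Hx; pose proof (E phi Hphi x Hx) as Ex.
  rewrite (Ker x Hx), (diff_op_eq_on I HI m b _ _
    (Dx_minus_log_deriv I phi N) x Hx), diff_op_zero in Ex.
  transitivity ((0 + r x * phi x) / phi x); [field; exact (N x Hx) |].
  rewrite <- Ex; field; exact (N x Hx). }
intros f Hf x Hx; rewrite (E f Hf x Hx), (R0 x Hx); ring.
Qed.

(** * The transformed operator *)

Lemma Dx_minus_diff_op (I : R -> Prop) (HI : open I) (g : R -> C) (m : nat)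
    (b : nat -> R -> C) :
  smooth_on I g -> smooth_coeffs I m b ->
  exists c, smooth_coeffs I (S m) c /\ c 0%nat = b 0%nat /\
    forall f, smooth_on I f ->
      eq_on I (diff_op (S m) c f) (Dx_minus g (diff_op m b f)).
Proof.
intros Hg Hb; destruct (Dx_diff_op I HI m b Hb) as [d [Hd Ed]].
exists (cons_coeff (b 0%nat) (fun k x => (- (1) * g x) * b k x + d k x)).
split; [| split; [reflexivity |]].
- apply smooth_coeffs_cons; [apply Hb; lia |].
  apply (smooth_coeffs_axpy I HI m (fun x => - (1) * g x)); [| exact Hb | exact Hd].
  apply (smooth_on_mult I HI); [now apply smooth_on_const | exact Hg].
- intros f Hf x Hx; unfold Dx_minus; rewrite (Ed f Hf x Hx), diff_op_S.
  change (tail (cons_coeff (b 0%nat) ?t)) with t.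
  rewrite (diff_op_axpy m (fun x => - (1) * g x)); cbn [cons_coeff]; ring.
Qed.

Lemma open_Rbar_interval (l r : Rbar) : open (Rbar_interval l r).
Proof. exact (open_and _ _ (open_Rbar_gt l) (open_Rbar_lt r)). Qed.

Theorem theorem1 (l r : Rbar) (hlr : Rbar_lt l r)
    (n : nat) (hn : (1 <= n)%nat)
    (a : nat -> R -> C) (ha : has_order (Rbar_interval l r) n a)
    (phi : R -> C) (hphi : smooth_on (Rbar_interval l r) phi)
    (hphi0 : nowhere_zero_on (Rbar_interval l r) phi)
    (hAphi : eq_on (Rbar_interval l r) (diff_op n a phi) (fun _ => RtoC 0))
    (lambda : C) (hlambda : lambda <> RtoC 0) :
  exists atilde ahat : nat -> R -> C,
    has_order (Rbar_interval l r) (n - 1) atilde /\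
    has_order (Rbar_interval l r) n ahat /\
    bijection_on (Rbar_interval l r)
      (eigenfunction (Rbar_interval l r) n a lambda)
      (eigenfunction (Rbar_interval l r) n ahat lambda)
      (Dx_minus (log_deriv phi)) /\
    (forall psi : R -> C,
       eigenfunction (Rbar_interval l r) n a lambda psi ->
       eq_on (Rbar_interval l r)
         (fun x => Cmult lambda (psi x))
         (diff_op (n - 1) atilde (Dx_minus (log_deriv phi) psi))).
Proof.
pose proof (open_Rbar_interval l r) as HI; revert HI ha hphi hphi0 hAphi.
generalize (Rbar_interval l r) as I; intros I HI [Ha Ha0] hphi hphi0 hAphi.
destruct n as [| m]; [lia |].
replace (S m - 1)%nat with m by lia.
pose proof (smooth_on_log_deriv I HI phi hphi hphi0) as Hg.
destruct (diff_op_factor I HI phi m a hphi hphi0 Ha hAphi)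
  as [b [Hb [Hb0 A_factor]]].
destruct (Dx_minus_diff_op I HI _ m b Hg Hb) as [c [Hc [Hc0 Ahat_factor]]].
set (g := log_deriv phi) in *.
assert (inverse : forall psi, eigenfunction I (S m) a lambda psi ->
  eq_on I (fun x => lambda * psi x) (diff_op m b (Dx_minus g psi))).
{ intros psi [Spsi Epsi] x Hx.
  now rewrite <- (A_factor psi Spsi x Hx), (Epsi x Hx). }
exists b, c; split; [split; [exact Hb | now rewrite Hb0] |].
split; [split; [exact Hc | now rewrite Hc0, Hb0] |].
split; [| exact inverse].
split; [| split].
- intros psi Hpsi; pose proof (proj1 Hpsi) as Spsi.
  pose proof (Dx_minus_smooth I HI g psi Hg Spsi) as Schi.
  split; [exact Schi |].
  intros x Hx; rewrite (Ahat_factor _ Schi x Hx).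
  rewrite <- (Dx_minus_eq_on I HI g _ _ (inverse psi Hpsi) x Hx).
  exact (Dx_minus_scal I lambda g psi Spsi x Hx).
- intros psi1 psi2 H1 H2 E x Hx.
  assert (El : lambda * psi1 x = lambda * psi2 x).
  { rewrite (inverse psi1 H1 x Hx), (inverse psi2 H2 x Hx).
    exact (diff_op_eq_on I HI m b _ _ E x Hx). }
  transitivity (/ lambda * (lambda * psi1 x)); [field; exact hlambda |].
  rewrite El; field; exact hlambda.
- intros chi [Schi Echi].
  pose proof (diff_op_smooth I HI m b chi Hb Schi) as SB.
  set (psi := fun x => / lambda * diff_op m b chi x).
  assert (Spsi : smooth_on I psi).
  { apply (smooth_on_mult I HI); [now apply smooth_on_const | exact SB]. }
  assert (Epsi : eq_on I (Dx_minus g psi) chi).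
  { intros x Hx; unfold psi.
    rewrite (Dx_minus_scal I (/ lambda) g _ SB x Hx).
    rewrite <- (Ahat_factor chi Schi x Hx), (Echi x Hx).
    field; exact hlambda. }
  exists psi; split; [split; [exact Spsi |] | exact Epsi].
  intros x Hx; rewrite (A_factor psi Spsi x Hx).
  rewrite (diff_op_eq_on I HI m b _ _ Epsi x Hx).
  unfold psi; field; exact hlambda.
Qed.
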